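(* Let $X$ be a finite set and let $\pi_X\in\Pi_l(X)$ be a labelled set partition all of whose blocks are singletons (each labelled or unlabelled). Then $\Pi_l(X,\pi_X)_0$ consists exactly of those $\pi\in\Pi_l(X,\pi_X)$ having at most one unlabelled block. Moreover, $\lambda(\pi)=\mu_{\Pi_l(X)}(\pi,\pi^* )$ for all $\pi\in\Pi_l(X,\pi_X)_0$.
   Context: For a finite set $X$ and a symbol $l\notin X$, a labelled set partition of $X$ is $\pi=\{B_1\cup L_1,\dots,B_k\cup L_k\}$ with $\{B_1,\dots,B_k\}$ a set partition of $X$ and $L_i\in\{\emptyset,\{l\}\}$ (labelled block iff $L_i=\{l\}$). $\Pi_l(X)$ is the set of these, ordered by $\sigma\le\pi$ iff every block of $\sigma$ (including $l$ if present) is contained in a block of $\pi$; $\mu_{\Pi_l(X)}$ is its Möbius function ($\mu(x,x)=1$, $\sum_{x\le z\le y}\mu(x,z)=0$ for $x<y$, $\mu(x,y)=0$ if $x\not\le y$). $m(\pi)=1$ if $\pi$ has exactly one labelled block, else $0$. $\Pi_l(X,\pi_X)=\{\pi\in\Pi_l(X):\pi\ge\pi_X,\ \pi\text{ has at least one labelled block}\}$. For $\pi\in\Pi_l(X,\pi_X)$, $\lambda(\pi)=\sum_{\sigma\in\Pi_l(X,\pi_X),\sigma\ge\pi}\mu_{\Pi_l(X)}(\pi,\sigma)m(\sigma)$, and $\Pi_l(X,\pi_X)_0=\{\pi\in\Pi_l(X,\pi_X):\lambda(\pi)\ne0\}$. For $\pi\in\Pi_l(X,\pi_X)$, $\pi^*$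 is the labelled set partition obtained from $\pi$ by uniting all its labelled blocks into a single labelled block (unlabelled blocks unchanged). *)

(* Defs.v *)
From HB Require Import structures.
From mathcomp Require Import all_boot all_order all_algebra.
Set Implicit Arguments.
Unset Strict Implicit.
Unset Printing Implicit Defensive.
Import Order.TTheory GRing.Theory Num.Theory.
Local Open Scope ring_scope.

Section Moebius.
Variables (d : Order.disp_t) (T : finPOrderType d).

(* The first argument is fuel for the recursion on [x, y[; moebius supplies
   the size of that interval, which always suffices (see moebius_lt). *)
Fixpoint moebius_rec (n : nat) (x y : T) : int :=
  if x == y then 1 else
  if n is n'.+1 then - \sum_(z : T | (x <= z < y)%O) moebius_rec n' x z
  else 0.

Definition moebius (x y : T) : int := moebius_rec #|[set z | (x <= z < y)%O]| x y.

Lemma moebius_rec_fuel n (x y : T) :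
  (#|[set z | (x <= z < y)%O]| <= n)%N -> moebius_rec n x y = moebius x y.
Proof.
suff main m k : (#|[set z | (x <= z < y)%O]| <= m)%N ->
    (#|[set z | (x <= z < y)%O]| <= k)%N ->
    moebius_rec m x y = moebius_rec k x y.
  by move=> le_n; apply: main.
elim: m k y => [|m IHm] [|k] y //=.
- rewrite leqn0 cards_eq0 => /eqP e0 _; case: ifP => // _.
  by rewrite big1 ?oppr0 // => z xzy; have := in_set0 z; rewrite -e0 inE xzy.
- move=> _; rewrite leqn0 cards_eq0 => /eqP e0; case: ifP => // _.
  by rewrite big1 ?oppr0 // => z xzy; have := in_set0 z; rewrite -e0 inE xzy.
move=> lem lek; case: ifP => // _; congr (- _); apply: eq_bigr => z /andP[xz zy].
have sub : [set t | (x <= t < z)%O] \proper [set t | (x <= t < y)%O].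
  apply/properP; split; last by exists z; rewrite !inE xz ?zy ?ltxx.
  by apply/subsetP => t; rewrite !inE => /andP[-> /lt_trans->].
have lt := proper_card sub.
by apply: IHm; rewrite -ltnS; apply: leq_trans lt _.
Qed.

Lemma moebius_xx (x : T) : moebius x x = 1.
Proof. by rewrite /moebius; case: #|_| => [|n] /=; rewrite eqxx. Qed.

Lemma moebius_lt (x y : T) :
  (x < y)%O -> \sum_(z : T | (x <= z <= y)%O) moebius x z = 0.
Proof.
move=> xy; rewrite (bigD1 y) /=; last by rewrite lexx (ltW xy).
set S := (X in (_ + X)).
suff -> : moebius x y = - S by rewrite addNr.
rewrite -(@moebius_rec_fuel #|[set z | (x <= z < y)%O]|.+1) //= lt_eqF //.
congr (- _); rewrite /S.
apply: eq_big => [z|z /andP[xz zy]]; first by rewrite lt_neqAle -andbA [(_ != _) && _]andbC.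
apply: moebius_rec_fuel; apply/subset_leq_card/subsetP => t.
by rewrite !inE => /andP[-> /lt_trans->].
Qed.

Lemma moebius_nle (x y : T) : ~~ (x <= y)%O -> moebius x y = 0.
Proof.
move=> nxy; rewrite /moebius; set n := #|_|; have xy : (x == y) = false.
  by apply: contraNF nxy => /eqP->.
case: n => [|n] /=; rewrite xy // big1 ?oppr0 // => z /andP[xz /ltW zy].
by rewrite (le_trans xz zy) in nxy.
Qed.

End Moebius.

(* Blocks are sets in option X: Some x stands for x \in X, None for the extra
   symbol l. *)
Definition lblock (X : finType) (B : {set X}) (b : bool) : {set option X} :=
  (Some @: B) :|: (if b then [set None] else set0).

Definition is_lpart (X : finType) (P : {set {set option X}}) : bool :=
  [exists D : {set {set X}}, [exists lab : {ffun {set X} -> bool},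
    partition D [set: X] && (P == [set lblock B (lab B) | B in D])]].

Record lpart (X : finType) := LPart {
  blocks :> {set {set option X}};
  blocksP : is_lpart blocks
}.

HB.instance Definition _ (X : finType) := [isSub for @blocks X].
HB.instance Definition _ (X : finType) := [Finite of lpart X by <:].

Section LpartTheory.
Variable X : finType.
Implicit Types (P : {set {set option X}}) (pi sigma : lpart X).

Lemma in_lblock (B : {set X}) b x : (Some x \in lblock B b) = (x \in B).
Proof.
rewrite inE (mem_imset _ _ Some_inj).
by case: b; rewrite !inE orbF.
Qed.

Lemma None_lblock (B : {set X}) b : (None \in lblock B b) = b.
Proof.
rewrite inE; have -> : (None \in Some @: B) = false by apply/imsetP => -[].
by case: b; rewrite !inE.
Qed.

Lemma is_lpartP P :
  reflect [/\ forall B, B \in P -> exists x, Some x \in B,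
              forall x, exists2 B, B \in P & Some x \in B
            & forall B C x, B \in P -> C \in P ->
                Some x \in B -> Some x \in C -> B = C]
          (is_lpart P).
Proof.
apply: (iffP existsP) => [[D /existsP[lab /andP[Dpart /eqP->]]]|[ne cov inj]].
  case/and3P: Dpart => /eqP covD trivD D0; split.
  - move=> _ /imsetP[B BD ->]; case: (set_0Vmem B) => [B0|[x xB]].
      by rewrite -B0 BD in D0.
    by exists x; rewrite in_lblock.
  - move=> x; have : x \in cover D by rewrite covD inE.
    case/bigcupP=> B BD xB; exists (lblock B (lab B)); last by rewrite in_lblock.
    exact: imset_f.
  - move=> _ _ x /imsetP[B BD ->] /imsetP[C CD ->]; rewrite !in_lblock => xB xC.
    by rewrite (_ : B = C) // -(def_pblock trivD BD xB) (def_pblock trivD CD xC).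
pose tr (B : {set option X}) := [set x | Some x \in B].
have trK B : lblock (tr B) (None \in B) = B.
  by apply/setP=> -[x|]; rewrite ?in_lblock ?None_lblock ?inE.
exists (tr @: P); apply/existsP.
exists [ffun A => lblock A true \in P]; apply/andP; split.
  apply/and3P; split.
  - apply/eqP/setP=> x; rewrite inE; apply/bigcupP.
    by have [B BP xB] := cov x; exists (tr B); rewrite ?imset_f ?inE.
  - apply/trivIsetP=> _ _ /imsetP[B BP ->] /imsetP[C CP ->] neq.
    rewrite -setI_eq0; apply: contraNT neq => /set0Pn[x]; rewrite !inE.
    by case/andP=> xB xC; rewrite (inj B C x).
  - apply/imsetP=> -[B /ne[x xB]] /setP/(_ x); by rewrite !inE xB.
have labE B : B \in P -> lblock (tr B) ([ffun A => lblock A true \in P] (tr B)) = B.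
  move=> BP; rewrite ffunE -[RHS]trK; congr lblock.
  have [lP|] := boolP (lblock (tr B) true \in P).
    have [x xB] := ne _ BP.
    by rewrite -(inj (lblock (tr B) true) B x) // ?None_lblock // in_lblock inE.
  by apply: contraNeq => nB; rewrite -{1}(trK B) in BP;
     move: nB BP; case: (None \in B).
rewrite -imset_comp; apply/eqP/setP=> B; apply/idP/imsetP => [BP|[C CP ->]].
  by exists B; rewrite //= labE.
by rewrite /= labE.
Qed.

Definition lpart_le sigma pi : bool :=
  [forall B in blocks sigma, [exists C in blocks pi, B \subset C]].

Lemma lpart_leP sigma pi :
  reflect (forall B, B \in blocks sigma -> exists2 C, C \in blocks pi & B \subset C)
          (lpart_le sigma pi).
Proof.
apply: (iffP forall_inP) => h B /h; first by case/exists_inP=> C; exists C.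
by case=> C CP BC; apply/exists_inP; exists C.
Qed.

Lemma lpart_le_refl : reflexive lpart_le.
Proof. by move=> pi; apply/lpart_leP => B; exists B. Qed.

Lemma lpart_le_trans : transitive lpart_le.
Proof.
move=> pi sigma tau /lpart_leP h1 /lpart_leP h2; apply/lpart_leP=> B /h1[C /h2[D DP CD] BC].
by exists D; rewrite ?(subset_trans BC).
Qed.

Lemma lpart_le_anti : antisymmetric lpart_le.
Proof.
have sub sigma pi : lpart_le sigma pi -> lpart_le pi sigma ->
    blocks sigma \subset blocks pi.
  move=> /lpart_leP h1 /lpart_leP h2; apply/subsetP=> B BS.
  have [C CP BC] := h1 B BS; have [D DS CD] := h2 C CP.
  have /is_lpartP[ne _ inj] := blocksP sigma; have [x xB] := ne B BS.
  have eBD : B = D.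
    by apply: (inj B D x) => //; apply: (subsetP CD); apply: (subsetP BC).
  suff -> : B = C by [].
  by apply/eqP; rewrite eqEsubset BC eBD.
move=> sigma pi /andP[h1 h2]; apply: val_inj; apply/eqP.
by rewrite eqEsubset !sub.
Qed.

(* Each labelled block is sent to the union of all labelled blocks. *)
Definition star_blocks P : {set {set option X}} :=
  [set if None \in (B : {set option X}) then cover [set C in P | None \in C] else B | B in P].

Lemma star_blocksP pi : is_lpart (star_blocks (blocks pi)).
Proof.
set P := blocks pi; have /is_lpartP[ne cov inj] : is_lpart P := blocksP pi.
pose U := cover [set C in P | None \in C].
pose f (B : {set option X}) := if None \in B then U else B.
have fsub B : B \in P -> B \subset f B.
  move=> BP; rewrite /f; case: ifP => // NB; apply/subsetP=> x xB.
  by apply/bigcupP; exists B; rewrite ?inE ?BP.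
have fE B C x : B \in P -> C \in P -> Some x \in C -> Some x \in f B -> f B = f C.
  move=> BP CP xC; rewrite {1 2}/f; case: ifP => NB.
    case/bigcupP=> D; rewrite inE => /andP[DP ND] xD.
    by rewrite /f (inj C D x) ?ND.
  by move=> xB; rewrite -(inj B C x) // /f NB.
apply/is_lpartP; split.
- move=> _ /imsetP[B BP ->]; have [x xB] := ne B BP.
  by exists x; apply: (subsetP (fsub B BP)).
- move=> x; have [B BP xB] := cov x; exists (f B); first exact: imset_f.
  exact: (subsetP (fsub B BP)).
move=> _ _ x /imsetP[B BP ->] /imsetP[C CP ->] xB xC.
have [D DP xD] := cov x.
by rewrite -/(f B) -/(f C) (fE B D x) // (fE C D x).
Qed.

End LpartTheory.

Fact lpart_display : Order.disp_t. Proof. exact: Order.Disp tt tt. Qed.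

HB.instance Definition _ (X : finType) :=
  Order.Le_isPOrder.Build lpart_display (lpart X)
    (@lpart_le_refl X) (@lpart_le_anti X) (@lpart_le_trans X).

Definition star (X : finType) (pi : lpart X) : lpart X :=
  LPart (star_blocksP pi).

Definition all_singletons (X : finType) (pi : lpart X) : Prop :=
  forall B, B \in blocks pi -> exists x b, B = lblock [set x] b.

Definition labelled (X : finType) (pi : lpart X) : {set {set option X}} :=
  [set B in blocks pi | None \in B].

Definition unlabelled (X : finType) (pi : lpart X) : {set {set option X}} :=
  [set B in blocks pi | None \notin B].

Definition mlab (X : finType) (pi : lpart X) : int := (#|labelled pi| == 1%N)%:R.

Definition lparts_above (X : finType) (piX : lpart X) : {set lpart X} :=
  [set pi | (piX <= pi)%O & (0 < #|labelled pi|)%N].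

Definition lambda (X : finType) (piX pi : lpart X) : int :=
  \sum_(sigma in lparts_above piX | (pi <= sigma)%O) moebius pi sigma * mlab sigma.

Definition lparts_above0 (X : finType) (piX : lpart X) : {set lpart X} :=
  [set pi in lparts_above piX | lambda piX pi != 0].

(* Main.v *)
Require Import Defs.
From mathcomp Require Import all_boot all_order all_algebra.
Set Implicit Arguments.
Unset Strict Implicit.
Unset Printing Implicit Defensive.
Import Order.TTheory GRing.Theory Num.Theory.
Local Open Scope ring_scope.

(* Everything rests on one property of closure operators f (Rota): if f moves
   pi, then the values mu(pi,x) over any fibre f x = w, x >= pi, sum to 0.
   - If sigma >= pi has exactly one labelled block and labels an element s that
     is unlabelled in pi, then f = "label the block of s" has the fibre {sigma}
     over sigma, so mu(pi,sigma) = 0.  Hence lambda(pi) is the sum of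
     mu(pi,sigma) over those sigma >= pi that unite the labelled blocks of pi
     and only merge its unlabelled blocks with one another.
   - If pi has at least two unlabelled blocks, these sigma form a fibre of
     f = "merge all unlabelled elements of pi", so lambda(pi) = 0.  Otherwise
     the only such sigma is pi^*.
   - mu(pi,pi^* ) <> 0: f = "merge a and b" yields by induction that mu(pi,x) has
     the sign (-1)^(number of blocks lost) for all x in [pi,pi^* ]. *)

(** * Möbius sums over the fibres of a closure operator *)

Lemma moebius_closure (d : Order.disp_t) (T : finPOrderType d) (f : T -> T)
    (x0 : T) :
  (forall x, (x <= f x)%O) -> {homo f : x y / (x <= y)%O} ->
  (forall x, f (f x) = f x) -> f x0 != x0 ->
  forall w, \sum_(x | (x0 <= x)%O && (f x == w)) moebius x0 x = 0.
Proof.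
move=> fge fhomo fid fx0 w.
have [n] := ubnP #|[set t | (t < w)%O]|; elim: n w => // n IHn w ltn.
have [fw|nfw] := eqVneq (f w) w; last first.
  rewrite big1 // => x /andP[_ /eqP fx].
  by rewrite -fx fid eqxx in nfw.
have [x0w|nx0w] := boolP (x0 <= w)%O; last first.
  rewrite big1 // => x /andP[x0x /eqP fx].
  by rewrite -fx (le_trans x0x (fge x)) in nx0w.
have lt_x0w : (x0 < w)%O.
  by rewrite lt_neqAle x0w andbT; apply: contraNneq fx0 => ->; rewrite fw.
have := moebius_lt lt_x0w.
(* For closed [w], the elements below [w] are those whose closure is below [w]. So the vanishing sum
   over [[x0, w]] splits into fibres over all [z <= w], and those over [z < w] vanish by
   induction. *)
have fle x : (f x <= w)%O = (x <= w)%O.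
  apply/idP/idP => [/(le_trans (fge x)) //|/fhomo]; by rewrite fw.
rewrite (partition_big f (fun z => z <= w)%O) /=; last first.
  by move=> x /andP[_]; rewrite fle.
rewrite (bigD1 w) //= [X in _ + X]big1 ?addr0 => [sum0|z /andP[zw nzw]].
  rewrite -[RHS]sum0; apply: eq_bigl => x; rewrite -andbA; congr andb; rewrite -fle.
  by case: eqP => [->|]; rewrite ?lexx ?andbF.
have ltzw : (z < w)%O by rewrite lt_neqAle nzw.
rewrite -[RHS](IHn z); last first.
  apply: leq_trans (_ : _ < #|[set t | (t < w)%O]|)%N _; last by [].
  apply: proper_card; apply/properP; split; last by exists z; rewrite !inE ?ltxx.
  by apply/subsetP => t; rewrite !inE => /lt_trans->.
apply: eq_bigl => x; rewrite -andbA; congr andb; rewrite -fle.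
by case: eqP => [->|]; rewrite ?zw ?andbF.
Qed.

(** * Labelled partitions as equivalence relations with labelled elements *)

Section LabelledPartitions.
Variable X : finType.
Implicit Types (pi sigma : lpart X) (S : pred X).

(** Exactly one block contains [x], so this union is that block; taking [cover] gives a total
    function without any choice. *)
Definition blk pi (x : X) : {set option X} :=
  cover [set B in blocks pi | Some x \in B].

Definition eqv pi (x y : X) := blk pi x == blk pi y.

Definition lab pi (x : X) := None \in blk pi x.

Lemma blkE pi B x : B \in blocks pi -> Some x \in B -> blk pi x = B.
Proof.
have /is_lpartP[_ _ inj] := blocksP pi => BP xB.
apply/setP => o; apply/bigcupP/idP => [[C]|oB]; last by exists B; rewrite ?inE ?BP.
by rewrite inE => /andP[CP xC]; rewrite (inj C B x).
Qed.

Lemma blkP pi x : blk pi x \in blocks pi /\ Some x \in blk pi x.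
Proof.
have /is_lpartP[_ cov _] := blocksP pi.
by have [B BP xB] := cov x; rewrite (blkE BP xB).
Qed.

Lemma in_blk pi x y : (Some y \in blk pi x) = eqv pi x y.
Proof.
apply/idP/eqP => [|->]; last by case: (blkP pi y).
by move/(blkE (proj1 (blkP pi x))).
Qed.

Lemma blocksE pi : blocks pi = [set blk pi x | x : X].
Proof.
apply/setP => B; apply/idP/imsetP => [BP|[x _ ->]]; last by case: (blkP pi x).
have /is_lpartP[ne _ _] := blocksP pi; have [x xB] := ne B BP.
by exists x; rewrite ?(blkE BP xB).
Qed.

Lemma eqvxx pi x : eqv pi x x. Proof. exact: eqxx. Qed.

Lemma eqvC pi x y : eqv pi x y = eqv pi y x. Proof. exact: eq_sym. Qed.

Lemma eqv_trans pi y x z : eqv pi x y -> eqv pi y z -> eqv pi x z.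
Proof. by move=> /eqP exy; rewrite /eqv exy. Qed.

Lemma eqv_lab pi x y : eqv pi x y -> lab pi x = lab pi y.
Proof. by rewrite /lab => /eqP->. Qed.

(** A block is known from its elements of [X] and its label, so the order becomes inclusion of
    equivalence relations and of sets of labelled elements. Most later arguments use this form
    instead of blocks. *)
Lemma lpart_lE pi sigma :
  reflect ((forall x y, eqv pi x y -> eqv sigma x y) /\
           (forall x, lab pi x -> lab sigma x))
          (pi <= sigma)%O.
Proof.
apply: (iffP (lpart_leP pi sigma)) => [h|[he hl] B].
  have sub x : blk pi x \subset blk sigma x.
    have [BP xB] := blkP pi x; have [C CP BC] := h _ BP.
    by rewrite (blkE CP) // (subsetP BC).
  split=> [x y|x]; last exact: (subsetP (sub x)).
  by rewrite -!in_blk; apply: (subsetP (sub x)).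
rewrite blocksE => /imsetP[x _ ->]; exists (blk sigma x); first by case: (blkP sigma x).
by apply/subsetP=> -[y|]; [rewrite !in_blk; apply: he | apply: hl].
Qed.

Lemma lpart_eqP pi sigma :
  eqv pi =2 eqv sigma -> lab pi =1 lab sigma -> pi = sigma.
Proof.
move=> he hl; apply/eqP; rewrite eq_le.
by apply/andP; split; apply/lpart_lE; split=> [x y|x]; rewrite ?he ?hl.
Qed.

(** * Labelled partitions given by the fibres of a map *)

(** The predicate [l] need not be constant on fibres: one element satisfying it labels its whole
    fibre. *)
Definition fibre_blocks (K : eqType) (k : X -> K) (l : pred X) :=
  [set lblock [set y | k y == k x] [exists y, (k y == k x) && l y] | x : X].

Lemma fibre_blocksP (K : eqType) (k : X -> K) (l : pred X) :
  is_lpart (fibre_blocks k l).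
Proof.
apply/is_lpartP; split.
- by move=> _ /imsetP[x _ ->]; exists x; rewrite in_lblock inE.
- move=> x; exists (lblock [set y | k y == k x] [exists y, (k y == k x) && l y]).
    exact: imset_f.
  by rewrite in_lblock inE.
move=> _ _ x /imsetP[y _ ->] /imsetP[z _ ->]; rewrite !in_lblock !inE.
by move=> /eqP-> /eqP->.
Qed.

Definition fibres (K : eqType) (k : X -> K) (l : pred X) : lpart X :=
  LPart (fibre_blocksP k l).

Lemma blk_fibres (K : eqType) (k : X -> K) (l : pred X) x :
  blk (fibres k l) x = lblock [set y | k y == k x] [exists y, (k y == k x) && l y].
Proof. by apply: blkE; [exact: imset_f | rewrite in_lblock inE]. Qed.

Lemma eqv_fibres (K : eqType) (k : X -> K) (l : pred X) x y :
  eqv (fibres k l) x y = (k x == k y).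
Proof. by rewrite -in_blk blk_fibres in_lblock inE eq_sym. Qed.

Lemma lab_fibres (K : eqType) (k : X -> K) (l : pred X) x :
  lab (fibres k l) x = [exists y, (k y == k x) && l y].
Proof. by rewrite /lab blk_fibres None_lblock. Qed.

(** * The closure operator that merges all blocks meeting a set *)

Definition meets pi S x := [exists y, eqv pi x y && S y].

Lemma meetsP pi S x : reflect (exists2 y, eqv pi x y & S y) (meets pi S x).
Proof. exact: exists_inP. Qed.

Lemma eqv_meets pi S x y : eqv pi x y -> meets pi S x = meets pi S y.
Proof. by rewrite /meets /eqv => /eqP->. Qed.

Lemma meets_self pi S x : S x -> meets pi S x.
Proof. by move=> Sx; apply/meetsP; exists x; rewrite ?eqvxx. Qed.

(** All blocks meeting [S] share the key [None]; any other block is its own key. *)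
Definition merge S pi : lpart X :=
  fibres (fun x => if meets pi S x then None else Some (blk pi x)) (lab pi).

Lemma eqv_merge S pi x y :
  eqv (merge S pi) x y = eqv pi x y || meets pi S x && meets pi S y.
Proof.
rewrite eqv_fibres; have [exy|] := boolP (eqv pi x y).
  by rewrite (eqv_meets S exy) (eqP exy) eqxx.
by rewrite /eqv; case: (meets pi S x); case: (meets pi S y) => // /negbTE.
Qed.

Lemma lab_merge S pi x :
  lab (merge S pi) x = [exists y, eqv (merge S pi) y x && lab pi y].
Proof. by rewrite lab_fibres; apply: eq_existsb => y; rewrite eqv_fibres. Qed.

Lemma merge_ge S pi : (pi <= merge S pi)%O.
Proof.
apply/lpart_lE; split=> [x y|x lx]; first by rewrite eqv_merge => ->.
by rewrite lab_merge; apply/existsP; exists x; rewrite eqvxx.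
Qed.

(* [merge S] is the join with the partition whose only non-singleton block is S. *)
Lemma merge_le S pi sigma :
  (merge S pi <= sigma)%O =
  (pi <= sigma)%O && [forall x, forall y, S x && S y ==> eqv sigma x y].
Proof.
apply/idP/andP => [le|[/lpart_lE[he hl] /forallP hS]].
  split; first exact: le_trans (merge_ge S pi) le.
  apply/forallP=> x; apply/forallP=> y; apply/implyP=> /andP[Sx Sy].
  by case/lpart_lE: le => + _; apply; rewrite eqv_merge !meets_self ?orbT.
have hm x y : eqv (merge S pi) x y -> eqv sigma x y.
  rewrite eqv_merge => /orP[/he //|/andP[/meetsP[u xu Su] /meetsP[v yv Sv]]].
  apply: eqv_trans (he _ _ xu) _; rewrite eqvC; apply: eqv_trans (he _ _ yv) _.
  by have /forallP/(_ u)/implyP := hS v; apply; rewrite Sv Su.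
apply/lpart_lE; split=> // x.
by rewrite lab_merge => /existsP[y /andP[/hm/eqv_lab<- /hl]].
Qed.

Lemma merge_homo S : {homo merge S : x y / (x <= y)%O}.
Proof.
move=> pi sigma le; have := lexx (merge S sigma).
by rewrite !merge_le => /andP[_ ->]; rewrite (le_trans le (merge_ge S sigma)).
Qed.

Lemma merge_id S pi : merge S (merge S pi) = merge S pi.
Proof.
apply/eqP; rewrite eq_le merge_ge andbT merge_le lexx /=.
by have := lexx (merge S pi); rewrite merge_le => /andP[].
Qed.

Lemma merge_eqv a b pi : eqv pi a b -> merge (pred2 a b) pi = pi.
Proof.
move=> ab; apply/eqP; rewrite eq_le merge_ge andbT merge_le lexx /=.
apply/forallP=> u; apply/forallP=> v; apply/implyP=> /andP[/pred2P[]-> /pred2P[]->];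
  by rewrite ?eqvxx // eqvC.
Qed.

(** * The closure operator that labels all blocks meeting a set *)

Definition label S pi : lpart X := fibres (blk pi) (fun x => lab pi x || S x).

Lemma eqv_label S pi x y : eqv (label S pi) x y = eqv pi x y.
Proof. exact: eqv_fibres. Qed.

Lemma lab_label S pi x : lab (label S pi) x = lab pi x || meets pi S x.
Proof.
rewrite lab_fibres; apply/existsP/orP.
  move=> [y /andP[exy /orP[ly|Sy]]]; first by left; rewrite -(eqv_lab exy).
  by right; apply/meetsP; exists y; rewrite // eqvC.
case=> [lx|/meetsP[y exy Sy]]; first by exists x; rewrite eqxx lx.
by exists y; rewrite Sy orbT andbT -/(eqv pi y x) eqvC.
Qed.

Lemma label_ge S pi : (pi <= label S pi)%O.
Proof. by apply/lpart_lE; split=> [x y|x]; rewrite ?eqv_label ?lab_label // => ->. Qed.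

Lemma label_homo S : {homo label S : x y / (x <= y)%O}.
Proof.
move=> pi sigma /lpart_lE[he hl]; apply/lpart_lE; split=> [x y|x].
  by rewrite !eqv_label; apply: he.
rewrite !lab_label => /orP[/hl-> //|/meetsP[y /he exy Sy]].
by apply/orP; right; apply/meetsP; exists y.
Qed.

Lemma label_id S pi : label S (label S pi) = label S pi.
Proof.
apply: lpart_eqP => [x y|x]; rewrite ?eqv_label // !lab_label.
have -> : meets (label S pi) S x = meets pi S x.
  by apply: eq_existsb => y; rewrite eqv_label.
by rewrite -orbA orbb.
Qed.

(** * The partition [star pi] in terms of elements *)

Lemma blk_star pi x :
  blk (star pi) x = if lab pi x then cover (labelled pi) else blk pi x.
Proof.
have [BP xB] := blkP pi x; apply: blkE.
  by apply/imsetP; exists (blk pi x).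
rewrite /lab; case: ifP => // lx; apply/bigcupP; exists (blk pi x) => //.
by rewrite inE BP.
Qed.

Lemma lab_star pi : lab (star pi) =1 lab pi.
Proof.
move=> x; rewrite {1}/lab blk_star; case: ifP => // lx.
by apply/bigcupP; exists (blk pi x); rewrite // inE (proj1 (blkP pi x)).
Qed.

Lemma eqv_star pi x y : eqv (star pi) x y = eqv pi x y || lab pi x && lab pi y.
Proof.
have cov z : (Some z \in cover (labelled pi)) = lab pi z.
  apply/bigcupP/idP => [[B]|lz].
    by rewrite inE /lab => /andP[BP NB] /(blkE BP)->.
  by exists (blk pi z); rewrite ?inE (proj1 (blkP pi z), proj2 (blkP pi z)).
rewrite -!in_blk blk_star; case lx: (lab pi x); last by rewrite orbF.
rewrite cov in_blk; apply/idP/orP => [->|[/eqv_lab<- //|//]]; by right.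
Qed.

Lemma star_ge pi : (pi <= star pi)%O.
Proof. by apply/lpart_lE; split=> [x y|x]; rewrite ?eqv_star ?lab_star // => ->. Qed.

(** * Bounds on the numbers of labelled and unlabelled blocks *)

Lemma labelled_gt0P pi : reflect (exists x, lab pi x) (0 < #|labelled pi|)%N.
Proof.
apply: (iffP card_gt0P) => [[B]|[x lx]].
  rewrite inE blocksE => /andP[/imsetP[x _ ->] lx]; by exists x.
by exists (blk pi x); rewrite inE (proj1 (blkP pi x)).
Qed.

Lemma labelled_le1P pi :
  reflect (forall x y, lab pi x -> lab pi y -> eqv pi x y) (#|labelled pi| <= 1)%N.
Proof.
apply: (iffP card_le1_eqP) => h => [x y lx ly|B C].
  by apply/eqP/h; rewrite inE (proj1 (blkP pi _)).
rewrite !inE !blocksE => /andP[/imsetP[x _ ->] lx] /andP[/imsetP[y _ ->] ly].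
exact/eqP/h.
Qed.

Lemma unlabelled_le1P pi :
  reflect (forall x y, ~~ lab pi x -> ~~ lab pi y -> eqv pi x y)
          (#|unlabelled pi| <= 1)%N.
Proof.
apply: (iffP card_le1_eqP) => h => [x y lx ly|B C].
  by apply/eqP/h; rewrite inE (proj1 (blkP pi _)).
rewrite !inE !blocksE => /andP[/imsetP[x _ ->] lx] /andP[/imsetP[y _ ->] ly].
exact/eqP/h.
Qed.

(** * Block counts and the sign of the Möbius function below [star pi] *)

(** A nonempty fibre determines its value, so sending a value to its fibre is injective on the image
    of [k]. *)
Lemma card_fibres (K : finType) (k : X -> K) :
  #|[set k x | x : X]| = #|[set [set y | k y == k x] | x : X]|.
Proof.
rewrite -(card_in_imset (f := fun z => [set y | k y == z])); last first.
  move=> _ _ /imsetP[x _ ->] /imsetP[y _ ->] /setP/(_ x).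
  by rewrite !inE eqxx => /esym/eqP.
by rewrite -imset_comp.
Qed.

Lemma card_blocks (K : finType) (k : X -> K) pi :
  (forall x y, eqv pi x y = (k x == k y)) -> #|blocks pi| = #|[set k x | x : X]|.
Proof.
move=> ke; rewrite blocksE (card_fibres (blk pi)) (card_fibres k).
apply: eq_card => B; congr (_ \in pred_of_set _).
by apply: eq_imset => x; apply/setP => y; rewrite !inE -ke.
Qed.

(** Redirecting the block of [b] to that of [a] gives a key [k] for the merged partition, whose
    values are all blocks of [pi] except that of [b]. *)
Lemma card_blocks_merge a b pi :
  ~~ eqv pi a b -> #|blocks pi| = #|blocks (merge (pred2 a b) pi)|.+1.
Proof.
move=> nab; pose k x := if eqv pi x b then blk pi a else blk pi x.
have meetsE x : meets pi (pred2 a b) x = eqv pi x a || eqv pi x b.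
  apply/meetsP/orP => [[y xy /pred2P[]<-]|[]]; [by left|by right| |].
    by exists a; rewrite //= eqxx.
  by exists b; rewrite //= eqxx orbT.
rewrite (@card_blocks _ k (merge _ _)); last first.
  move=> x y; rewrite eqv_merge !meetsE /k.
  case xb: (eqv pi x b); case yb: (eqv pi y b).
  - by rewrite !orbT eqxx ?orbT.
  - rewrite orbT orbF /= -/(eqv pi a y) [eqv pi a y]eqvC.
    case: (boolP (eqv pi x y)) => // xy; move: yb.
    by rewrite -xb /eqv -(eqP xy) -/(eqv pi x b) xb.
  - rewrite orbT orbF andbT -/(eqv pi x a).
    case: (boolP (eqv pi x y)) => // xy; move: xb.
    by rewrite /eqv (eqP xy) -/(eqv pi y b) yb.
  rewrite !orbF; case: (boolP (eqv pi x y)) => [xy|/negbTE nxy].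
    by rewrite -/(eqv pi x y) xy.
  rewrite -/(eqv pi x y) nxy /=; apply/andP=> -[xa ya]; move: nxy.
  by rewrite /eqv (eqP xa) (eqP ya) eqxx.
rewrite (cardsD1 (blk pi b) (blocks pi)) (proj1 (blkP pi b)) add1n; congr _.+1.
apply: eq_card => B; rewrite !inE blocksE.
apply/andP/imsetP => [[nB /imsetP[x _ eB]]|[x _ ->]].
  by exists x; rewrite // /k /eqv -eB (negbTE nB).
rewrite /k; case: ifP => [_|/negbT nxb]; first by split=> //; apply: imset_f.
by split=> //; apply: imset_f.
Qed.

(* Weisner: when a and b lie in distinct blocks of pi, mu(pi,x) is minus the sum
   of the mu(pi,y) over the other y whose join with the atom {a,b} is x; all
   these y have exactly one block more than x. *)
Lemma moebius_star_sign pi x :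
  (pi <= x)%O -> (x <= star pi)%O ->
  0 < (-1) ^+ (#|blocks pi| + #|blocks x|) * moebius pi x.
Proof.
have [n] := ubnP #|[set t | (t < x)%O]|; elim: n x => // n IHn x ltn pix xs.
have [->|npix] := eqVneq x pi.
  by rewrite moebius_xx mulr1 addnn -mul2n exprM sqrrN !expr1n.
have /lpart_lE[pix_e pix_l] := pix; have /lpart_lE[xs_e xs_l] := xs.
have labE : lab x =1 lab pi.
  by move=> u; apply/idP/idP => [/xs_l|/pix_l //]; rewrite lab_star.
(* As [x] has the labels of [pi], it can differ from [pi] only by merging blocks. *)
have [a [b [xab npab]]] : exists a b, eqv x a b /\ ~~ eqv pi a b.
  case: (boolP [exists a, [exists b, eqv x a b && ~~ eqv pi a b]]).
    by case/existsP=> a /existsP[b /andP[]]; exists a, b.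
  rewrite negb_exists => /forallP H; case/eqP: npix; apply: lpart_eqP => // u v.
  apply/idP/idP => [uv|/pix_e //]; have := H u; rewrite negb_exists => /forallP/(_ v).
  by rewrite uv negbK.
have [la lb] : lab pi a /\ lab pi b.
  by have := xs_e _ _ xab; rewrite eqv_star (negbTE npab) => /andP.
set f := merge (pred2 a b).
have fx : f x = x by apply: merge_eqv.
have fnab y : f y = x -> y != x -> ~~ eqv y a b.
  by move=> fy; apply: contraNN => yab; rewrite -fy /f merge_eqv.
have sum0 : \sum_(y | (pi <= y)%O && (f y == x)) moebius pi y = 0.
  apply: moebius_closure; [exact: merge_ge|exact: merge_homo|exact: merge_id|].
  apply: contraNneq npab => <-; by rewrite eqv_merge !meets_self ?orbT //= eqxx ?orbT.
(* The minus sign from isolating the term at [x] is absorbed by the one extra block of each [y]. *)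
have muE : (-1) ^+ (#|blocks pi| + #|blocks x|) * moebius pi x =
    \sum_(y | [&& (pi <= y)%O, f y == x & y != x])
      (-1) ^+ (#|blocks pi| + #|blocks y|) * moebius pi y.
  move: sum0; rewrite (bigD1 x) /= ?fx ?eqxx ?pix // => /eqP.
  rewrite addr_eq0 => /eqP->; rewrite -sumrN mulr_sumr.
  apply: eq_big => [y|y /andP[/andP[_ /eqP fy] nyx]]; first by rewrite andbA.
  rewrite (card_blocks_merge (fnab y fy nyx)) -/f fy addnS exprS.
  by rewrite mulrN mulN1r mulNr.
have pos y : [&& (pi <= y)%O, f y == x & y != x] ->
    0 < (-1) ^+ (#|blocks pi| + #|blocks y|) * moebius pi y.
  case/and3P=> piy /eqP fy nyx.
  have ltyx : (y < x)%O by rewrite lt_neqAle nyx -fy merge_ge.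
  apply: IHn => //; last exact: le_trans (ltW ltyx) xs.
  apply: leq_trans (_ : _ < #|[set t | (t < x)%O]|)%N _; last by [].
  apply: proper_card; apply/properP; split; last by exists y; rewrite !inE ?ltxx.
  by apply/subsetP => t; rewrite !inE => /lt_trans->.
(* A term showing that the sum is not empty: cut the [x]-block of [a] into the [pi]-block of [a] and
   the rest, which contains [b]. Merging [a] and [b] undoes the cut. *)
pose y := fibres (fun u => (blk x u, eqv pi a u)) (lab x).
have yE u v : eqv y u v = eqv x u v && (eqv pi a u == eqv pi a v).
  by rewrite eqv_fibres.
have ylab u : lab y u = lab x u.
  rewrite lab_fibres; apply/existsP/idP => [[v]|lu]; last by exists u; rewrite eqxx lu.
  by rewrite xpair_eqE => /andP[/andP[/eqv_lab<- _]].
have yx : (y <= x)%O.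
  by apply/lpart_lE; split=> [u v|u]; rewrite ?ylab // yE => /andP[].
have yP : [&& (pi <= y)%O, f y == x & y != x].
  apply/and3P; split.
  - apply/lpart_lE; split=> [u v uv|u]; last by rewrite ylab labE.
    by rewrite yE pix_e //= /eqv (eqP uv).
  - rewrite eq_le; apply/andP; split; first by rewrite -[X in (_ <= X)%O]fx merge_homo.
    apply/lpart_lE; split=> [u v xuv|u xu]; last first.
      by have /lpart_lE[_] := merge_ge (pred2 a b) y; apply; rewrite ylab.
    have side w : eqv x a w -> meets y (pred2 a b) w.
      move=> xaw; apply/meetsP; case aw: (eqv pi a w).
        by exists a; rewrite /= ?eqxx // yE eqvC xaw aw eqvxx.
      exists b; rewrite /= ?eqxx ?orbT // yE aw (negbTE npab) eqxx andbT.
      by apply: eqv_trans xab; rewrite eqvC.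
    rewrite eqv_merge yE xuv /=; case: eqP => //= nuv.
    (* If [y] separates [u] and [v], exactly one of them is in the [pi]-block of [a], so both lie in
       the [x]-block of [a]. *)
    suff xau : eqv x a u by rewrite !side // (eqv_trans xau xuv).
    case au: (eqv pi a u); first exact: pix_e.
    case av: (eqv pi a v); last by rewrite au av in nuv.
    by apply: eqv_trans (pix_e _ _ av) _; rewrite eqvC.
  by apply: contraTneq xab => <-; rewrite yE eqvxx (negbTE npab) andbF.
rewrite muE (bigD1 y) //; apply: ltr_pwDl; first exact: pos.
by apply: sumr_ge0 => z /andP[/pos/ltW].
Qed.

Lemma moebius_star_neq0 pi : moebius pi (star pi) != 0.
Proof.
by have := moebius_star_sign (star_ge pi) (lexx _); apply: contraTneq => ->; rewrite mulr0.
Qed.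

(** * Evaluation of [lambda] *)

Lemma moebius_new_label pi sigma s :
  (pi <= sigma)%O -> (0 < #|labelled pi|)%N -> (#|labelled sigma| <= 1)%N ->
  lab sigma s -> ~~ lab pi s -> moebius pi sigma = 0.
Proof.
move=> le /labelled_gt0P[t lt] /labelled_le1P one ls nls.
have := @moebius_closure _ _ (label (pred1 s)) pi (label_ge _) (@label_homo _)
  (label_id _) _ sigma.
rewrite (bigD1 sigma) /=; last first.
  rewrite le eq_le label_ge andbT; apply/lpart_lE; split=> [x y|x].
    by rewrite eqv_label.
  by rewrite lab_label => /orP[//|/meetsP[y /eqv_lab-> /eqP->]].
rewrite big1 ?addr0 => [->//|x /andP[/andP[pix /eqP fx] nx]].
  by apply: contraNneq nls => <-; rewrite lab_label meets_self ?orbT //=.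
(* Any [x] in the fibre has the equivalence relation of [sigma]. The label of [t], inherited from
   [pi], already labels the only labelled block of [sigma], so [x] is [sigma]. *)
case/eqP: nx; have exy u v : eqv x u v = eqv sigma u v by rewrite -fx eqv_label.
apply: lpart_eqP => // u; apply/idP/idP => [lu|lu].
  by rewrite -fx lab_label lu.
have /lpart_lE[_ hl] := pix; have /lpart_lE[_ hs] := le.
have /eqv_lab <- : eqv x t u by rewrite exy one // hs.
exact: hl.
Qed.

(** Terms with a new label vanish by [moebius_new_label]. Every [sigma] above [pi] is above [piX]
    and has a labelled block, so the bound [<= 1] already means exactly one. *)
Lemma lambdaE piX pi : pi \in lparts_above piX ->
  lambda piX pi =
  \sum_(sigma | [&& (pi <= sigma)%O, (#|labelled sigma| <= 1)%N
                 & [forall x, lab sigma x == lab pi x]]) moebius pi sigma.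
Proof.
rewrite inE => /andP[piX_pi lab_pi]; rewrite /lambda /mlab.
have gt0 sigma : (pi <= sigma)%O -> (0 < #|labelled sigma|)%N.
  have /labelled_gt0P[x lx] := lab_pi.
  by move=> /lpart_lE[_ hl]; apply/labelled_gt0P; exists x; apply: hl.
rewrite (bigID (fun sigma => (#|labelled sigma| == 1%N)
  && [forall x, lab sigma x == lab pi x])) /= [X in _ + X]big1 ?addr0; last first.
  move=> sigma /andP[/andP[_ le]]; case: eqP => [one /=|_ _]; last by rewrite mulr0.
  rewrite negb_forall => /existsP[x nx].
  rewrite (@moebius_new_label pi sigma x) ?mul0r ?one //.
    by apply: contraNT nx => nl; rewrite (negbTE nl) eq_sym; apply/eqP;
       apply: contraNF nl; have /lpart_lE[_] := le; apply.
  apply: contraNN nx => lx; rewrite lx; apply/eqP.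
  by have /lpart_lE[_] := le; apply.
apply: eq_big => [sigma|sigma /andP[_ /andP[-> _]]]; last by rewrite mulr1.
rewrite inE; case: (boolP (pi <= sigma)%O) => [le|]; last by rewrite andbF.
by rewrite (le_trans piX_pi le) gt0 //= eqn_leq gt0 // andbT.
Qed.

Lemma lambda_unlabelled_le1 piX pi :
  pi \in lparts_above piX -> (#|unlabelled pi| <= 1)%N ->
  lambda piX pi = moebius pi (star pi).
Proof.
move=> pi_above /unlabelled_le1P un; rewrite (lambdaE pi_above).
rewrite (big_pred1 (star pi)) // => sigma; apply/and3P/eqP.
  case=> /lpart_lE[he hl] /labelled_le1P one /forallP labE.
  apply: lpart_eqP => [x y|x]; last by rewrite lab_star (eqP (labE x)).
  rewrite eqv_star; apply/idP/orP => [exy|[/he //|/andP[lx ly]]]; last first.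
    by apply: one; rewrite (eqP (labE _)).
  have := eqv_lab exy; rewrite !(eqP (labE _)).
  case lx: (lab pi x) => <-; first by right.
  have := eqv_lab exy; rewrite !(eqP (labE _)) lx => ly.
  by left; apply: un; rewrite ?lx -?ly.
move=> ->; split.
- exact: star_ge.
- by apply/labelled_le1P => x y; rewrite !lab_star eqv_star => -> ->; rewrite orbT.
by apply/forallP=> x; rewrite lab_star.
Qed.

Lemma lambda_unlabelled_gt1 piX pi :
  pi \in lparts_above piX -> (1 < #|unlabelled pi|)%N -> lambda piX pi = 0.
Proof.
move=> pi_above; rewrite ltnNge => un; rewrite (lambdaE pi_above).
pose S := [pred x | ~~ lab pi x].
(* The elements labelled in [pi] form one labelled block of [w], the others one unlabelled block. *)
pose w := fibres (lab pi) (lab pi).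
have we x y : eqv w x y = (lab pi x == lab pi y) by rewrite eqv_fibres.
have wl x : lab w x = lab pi x.
  rewrite lab_fibres; apply/existsP/idP => [[y /andP[/eqP<-]] //|lx].
  by exists x; rewrite eqxx.
rewrite -[RHS](@moebius_closure _ _ (merge S) pi (merge_ge _) (@merge_homo _)
  (merge_id _) _ w); last first.
  apply: contraNneq un => fpi; apply/unlabelled_le1P => x y nx ny.
  by rewrite -fpi eqv_merge !meets_self ?orbT.
apply: eq_bigl => sigma; case: (boolP (pi <= sigma)%O) => //= /lpart_lE[he hl].
apply/andP/eqP => [[/labelled_le1P one /forallP labE]|ew].
  have mE x : meets sigma S x = ~~ lab pi x.
    apply/meetsP/idP => [[y /eqv_lab]|nx]; last by exists x; rewrite ?eqvxx.
    by rewrite !(eqP (labE _)) => ->.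
  have eE x y : eqv (merge S sigma) x y = (lab pi x == lab pi y).
    rewrite eqv_merge !mE; case: (boolP (eqv sigma x y)) => [/eqv_lab|nxy].
      by rewrite !(eqP (labE _)) => ->; rewrite eqxx.
    move: nxy; case lx: (lab pi x); case ly: (lab pi y) => //.
    by rewrite one // (eqP (labE _)).
  apply: lpart_eqP => [x y|x]; first by rewrite eE we.
  rewrite lab_merge wl; apply/existsP/idP => [[y]|lx].
    by rewrite eE (eqP (labE y)) => /andP[/eqP->].
  by exists x; rewrite eqvxx (eqP (labE x)).
(* The labels of [sigma] lie between those of [pi] and those of [w], which agree. *)
have labE x : lab sigma x = lab pi x.
  apply/idP/idP => [lx|/hl //]; rewrite -wl -ew.
  by have /lpart_lE[_] := merge_ge S sigma; apply.
split; last by apply/forallP=> x; rewrite labE.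
apply/labelled_le1P => x y; rewrite !labE => lx ly.
(* Merging only joins blocks containing an element of [S], and a labelled block of [sigma] contains
   none; so [x] and [y] were equivalent in [sigma] already. *)
have : eqv w x y by rewrite we lx ly.
rewrite -ew eqv_merge => /orP[//|/andP[/meetsP[z /eqv_lab]]].
by rewrite !labE lx /= => <-.
Qed.

End LabelledPartitions.

Theorem theorem6p11 (X : finType) (piX : lpart X) (hX : all_singletons piX) :
  lparts_above0 piX = [set pi in lparts_above piX | (#|unlabelled pi| <= 1)%N] /\
  (forall pi : lpart X, pi \in lparts_above0 piX ->
     lambda piX pi = moebius pi (star pi)).
Proof.
have lambda0 pi : pi \in lparts_above piX ->
    (lambda piX pi != 0) = (#|unlabelled pi| <= 1)%N.
  move=> pi_above; case: leqP => [le1|gt1].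
    by rewrite lambda_unlabelled_le1 // moebius_star_neq0.
  by rewrite lambda_unlabelled_gt1 ?eqxx.
split=> [|pi]; last first.
  rewrite inE => /andP[pi_above]; rewrite lambda0 //.
  exact: lambda_unlabelled_le1.
apply/setP => pi; rewrite [in LHS]inE [in RHS]inE.
by have [/lambda0|] := boolP (pi \in lparts_above piX).
Qed.
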